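(* Let $\mathfrak{I}$ be a loopblind boolean interaction family that is functionally representable and contraction-closed. Let $\mathcal{M}=\mathcal{M}(G;\mathfrak{I})$ be the hypergraphical model induced by $\mathfrak{I}$ on a loopless hypergraph $G=(V,E)$, and let $e\in E$ with decomposition $e=I\sqcup D$ and dependency map $\sigma$. Then, for all $A\subseteq E\setminus\{e\}$, $$ (r_{\mathcal{M}}/e)(A)=|D|+r_{\mathcal{M}/_{\mathfrak{I},\sigma}e}(A),\qquad (r_{\mathcal{M}}\setminus e)(A)=r_{\mathcal{M}\setminus e}(A).$$
   Context: Hypergraphs. A hypergraph $G=(V,E)$ has a finite vertex set $V$ and a finite multiset $E$ of hyperedges, each a finite multiset of elements of $V$ (empty hyperedges allowed; repeated hyperedges count as distinct elements of $E$). $G$ is loopless if every hyperedge is a set. Interaction families. A boolean interaction family $\mathfrak{I}=(S,\{\Phi^k\}_{k\ge0})$ is a finite set $S$, $q=|S|\ge2$, with permutation-invariant functions $\Phi^k\colon S^k\to\{0,1\}$; for a finite (multi)set $A$ of indices, $\Phi^{|A|}(\boldsymbol{s}|_A)$ is $\Phi^{|A|}$ applied to the entries $s_i$, $i\in A$ (with multiplicity). Put $K_{\Phi^k}=\{\boldsymbol{s}\in S^k\mid\Phi^k(\boldsymbol{s})=1\}$. The induced model $\mathcal{M}(G;\mathfrak{I})$ has interaction functions $\phi^e(\boldsymbol{s})=\Phi^{|e|}(\boldsymbol{s}|_e)$, $\boldsymbol{s}\in S^V$, $e\in E$. Loopblind: for every $k>0$ and every multisubset $A$ of $[k]$ such that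 $\boldsymbol{s}\mapsto\Phi^{|A|}(\boldsymbol{s}|_A)$ is not constant on $S^k$, there is a unique subset (set) $A'\subseteq A$ with $\Phi^{|A|}(\boldsymbol{s}|_A)=\Phi^{|A'|}(\boldsymbol{s}|_{A'})$ for all $\boldsymbol{s}\in S^k$. Functionally representable: for every $k$ there is a partition $[k]=I\sqcup D$ and a map $\sigma\colon S^{|I|}\to S^{|D|}$ (dependency map) with $K_{\Phi^k}=\{(\boldsymbol{s}_I,\sigma(\boldsymbol{s}_I))\mid\boldsymbol{s}_I\in S^{|I|}\}$ ($\boldsymbol{s}_I$ placed on $I$, $\sigma(\boldsymbol{s}_I)$ on $D$). A decomposition of a hyperedge $e$ of a loopless hypergraph is $e=I\sqcup D$ with $\sigma\colon S^I\to S^D$ obtained from such data for $k=|e|$ via an enumeration of $e$. Contraction-closed: for every $k$, every $k'\ge k$ and every partition $[k]=I\sqcup D$ with a map $\sigma\colon S^{|I|}\to S^{|D|}$ satisfying $K_{\Phi^k}=\{(\boldsymbol{s}_I,\sigma(\boldsymbol{s}_I))\mid\boldsymbol{s}_I\in S^{|I|}\}$ ($\boldsymbol{s}_I$ placed on $I$, $\sigma(\boldsymbol{s}_I)$ on $D$), let $\hat\sigma\colon S^{[k']\setminus D}\to S^{[k']}$, $\hat\sigma(\boldsymbol{s})|_{[k']\setminus D}=\boldsymbol{s}$, $\hat\sigma(\boldsymbol{s})|_D=\sigma(\boldsymbol{s}|_I)$; then for every $A\subseteq[k']$ either $\Phi^{|A|}(\hat\sigma(\boldsymbol{s})|_A)$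 is constant in $\boldsymbol{s}$, or there is a unique $A'\subseteq[k']\setminus D$ with $\Phi^{|A|}(\hat\sigma(\boldsymbol{s})|_A)=\Phi^{|A'|}(\boldsymbol{s}|_{A'})$ for all $\boldsymbol{s}\in S^{[k']\setminus D}$. Deletion and contraction. $G\setminus e=(V,E\setminus\{e\})$ and $\mathcal{M}\setminus e=\mathcal{M}(G\setminus e;\mathfrak{I})$. Given $e=I\sqcup D$ with $\sigma$, let $\hat\sigma\colon S^{V\setminus D}\to S^V$ be the identity on $V\setminus D$ and $\hat\sigma(\boldsymbol{s})|_D=\sigma(\boldsymbol{s}|_I)$. For $f\in E\setminus\{e\}$ let $\widetilde\phi^f(\boldsymbol{s})=\Phi^{|f|}(\hat\sigma(\boldsymbol{s})|_f)$, which depends only on $\boldsymbol{s}|_{(f\cup I)\setminus D}$. Set $f^*=\emptyset$ if $\widetilde\phi^f$ is constant; otherwise $f^*$ is the unique subset of $(f\cup I)\setminus D$ with $\widetilde\phi^f(\boldsymbol{s})=\Phi^{|f^*|}(\boldsymbol{s}|_{f^*})$ for all $\boldsymbol{s}$ (it exists and is unique by contraction-closedness). Then $G/_{\mathfrak{I},\sigma}e=(V\setminus D,\{f^*\mid f\in E\setminus\{e\}\})$, with hyperedge multiset indexed by $E\setminus\{e\}$ via $f\mapsto f^*$, and $\mathcal{M}/_{\mathfrak{I},\sigma}e=\mathcal{M}(G/_{\mathfrak{I},\sigma}e;\mathfrak{I})$; its rank function is regarded as a function on subsets of $E\setminus\{e\}$. Rank functions. $R_{\mathcal{M}}(A)=\#\{\boldsymbol{s}\in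 S^V\mid\phi^f(\boldsymbol{s})=1\ \forall f\in A\}$; $r_{\mathcal{M}}(A)=|V|-\log_qR_{\mathcal{M}}(A)$ if $R_{\mathcal{M}}(A)>0$ and $\infty$ otherwise ($V$ being the vertex set of the model's hypergraph). For a set function $r$ on $2^E$: $(r\setminus e)(A)=r(A)$ and $(r/e)(A)=r(A\cup\{e\})$ for $A\subseteq E\setminus\{e\}$. *)

(* Defs.v *)
From HB Require Import structures.
From mathcomp Require Import all_boot all_order all_algebra all_fingroup.
From mathcomp Require Import finmap multiset.
From mathcomp Require Import all_classical all_reals all_analysis.

Set Implicit Arguments.
Unset Strict Implicit.
Unset Printing Implicit Defensive.
Import Order.TTheory GRing.Theory Num.Theory.

(* The multiset [E] is indexed by the finite type [hyperedge], so repeated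
   hyperedges are distinct elements of it. *)
Record hypergraph := Hypergraph {
  vertex : finType;
  hyperedge : finType;
  incidence : hyperedge -> {mset vertex}%mset
}.

Definition loopless (G : hypergraph) : Prop :=
  forall (f : hyperedge G) (v : vertex G), incidence f v <= 1.

Definition mset_of_set (T : finType) (A : {set T}) : {mset T}%mset :=
  seq_mset (enum A).

Definition constant_fun (X : finType) (Y : eqType) (F : X -> Y) : bool :=
  [forall x, forall y, F x == F y].

Record interaction_family := InteractionFamily {
  spin : finType;
  spin_gt1 : 1 < #|spin|;
  Phi : forall k : nat, {ffun 'I_k -> spin} -> bool;
  Phi_perm : forall (k : nat) (p : 'S_k) (s : {ffun 'I_k -> spin}),
    Phi [ffun i => s (p i)] = Phi s
}.

(* [Phi_on J A s] is Phi^{|A|}(s|_A): the values of [s] on [A], listed with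
   multiplicity; the order of the list is irrelevant by [Phi_perm]. *)
Definition Phi_on (J : interaction_family) (T : finType) (A : {mset T}%mset)
    (s : {ffun T -> spin J}) : bool :=
  let w := [seq s x | x <- A] in Phi (finfun (tnth (in_tuple w))).

Definition K_Phi (J : interaction_family) (k : nat) :
    {set {ffun 'I_k -> spin J}} :=
  [set s | Phi s].

Definition loopblind (J : interaction_family) : Prop :=
  forall (k : nat) (A : {mset 'I_k}%mset), 0 < k ->
    ~~ constant_fun (fun s : {ffun 'I_k -> spin J} => Phi_on A s) ->
    exists! A' : {set 'I_k},
      {subset A' <= A} /\
      forall s : {ffun 'I_k -> spin J}, Phi_on A s = Phi_on (mset_of_set A') s.

Definition assignment (S T : finType) (A : {set T}) : predArgType :=
  {ffun {x : T | x \in A} -> S}.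

Definition restrict (S T : finType) (A : {set T}) (s : {ffun T -> S}) :
    assignment S A :=
  [ffun x => s (val x)].

(* Disjoint sets I (independent) and D (dependent) of elements of [T], with a
   map sigma : S^I -> S^D. *)
Record splitting (S T : finType) := Splitting {
  indep : {set T};
  dep : {set T};
  indep_dep_disjoint : [disjoint indep & dep];
  depmap : assignment S indep -> assignment S dep
}.

Lemma indep_notin_dep (S T : finType) (d : splitting S T)
  (i : {x : T | x \in indep d}) : val i \notin dep d.
Proof. by rewrite (disjointFr (indep_dep_disjoint d) (valP i)). Qed.

(* sigma-hat : S^{T \ D} -> S^T. *)
Definition extend (S T : finType) (d : splitting S T)
    (s : {ffun {x : T | x \notin dep d} -> S}) : {ffun T -> S} :=
  [ffun x => match boolP (x \in dep d) with
    | AltTrue xD =>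
        depmap [ffun i : {x : T | x \in indep d} =>
                  s (exist _ (val i) (indep_notin_dep i))] (exist _ x xD)
    | AltFalse xND => s (exist _ x xND)
    end].

Definition represents (J : interaction_family) (k : nat)
    (d : splitting (spin J) 'I_k) : Prop :=
  indep d :|: dep d = [set: 'I_k] /\
  forall s : {ffun 'I_k -> spin J},
    s \in K_Phi J k <->
    exists sI : assignment (spin J) (indep d),
      restrict (indep d) s = sI /\ restrict (dep d) s = depmap sI.

Definition functionally_representable (J : interaction_family) : Prop :=
  forall k : nat, exists d : splitting (spin J) 'I_k, represents d.

Definition corresponds (S T T' : finType) (g : T -> T') (A : {set T})
    (A' : {set T'}) (s : assignment S A) (s' : assignment S A') : Prop :=
  forall (i : {x : T | x \in A}) (j : {y : T' | y \in A'}),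
    val j = g (val i) -> s i = s' j.

(* [d'] is the image of [d] under the injection [g]. *)
Definition transported (S T T' : finType) (g : T -> T') (d : splitting S T)
    (d' : splitting S T') : Prop :=
  [/\ indep d' = g @: indep d,
      dep d' = g @: dep d
    & forall (s : assignment S (indep d)) (s' : assignment S (indep d')),
        corresponds g s s' -> corresponds g (depmap s) (depmap s')].

Definition splits_along (J : interaction_family) (k : nat) (T : finType)
    (g : 'I_k -> T) (d : splitting (spin J) T) : Prop :=
  exists2 d0 : splitting (spin J) 'I_k, represents d0 & transported g d0 d.

(* [k] is regarded as a subset of [k'] along [widen_ord]; subsets of
   [k'] \ D are subsets of the type {x | x \notin dep d}. *)
Definition contraction_closed (J : interaction_family) : Prop :=
  forall (k k' : nat) (lekk' : k <= k') (d : splitting (spin J) 'I_k'),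
    splits_along (widen_ord lekk') d ->
    forall A : {set 'I_k'},
      constant_fun (fun s => Phi_on (mset_of_set A) (@extend _ _ d s)) \/
      exists! A' : {set {x : 'I_k' | x \notin dep d}},
        forall s, Phi_on (mset_of_set A) (@extend _ _ d s)
                  = Phi_on (mset_of_set A') s.

Definition edge_set (G : hypergraph) (e : hyperedge G) : {set vertex G} :=
  [set v | v \in incidence e].

(* Decompositions of a hyperedge of a loopless hypergraph. *)
Definition decomposition (J : interaction_family) (G : hypergraph)
    (e : hyperedge G) (d : splitting (spin J) (vertex G)) : Prop :=
  exists g : 'I_#|edge_set e| -> vertex G,
    [/\ injective g, g @: [set: _] = edge_set e & splits_along g d].

Definition edge_deletion (G : hypergraph) (e : hyperedge G) : hypergraph :=
  @Hypergraph (vertex G) {f : hyperedge G | f != e}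
    (fun f => incidence (val f)).

Definition contracted_interaction (J : interaction_family) (G : hypergraph)
    (d : splitting (spin J) (vertex G)) (f : hyperedge G)
    (s : {ffun {x : vertex G | x \notin dep d} -> spin J}) : bool :=
  Phi_on (incidence f) (extend s).

(* f^*; if the contracted interaction is not constant and the family is
   contraction-closed, at most one set satisfies the predicate given to
   [pick]. *)
Definition contracted_edge (J : interaction_family) (G : hypergraph)
    (d : splitting (spin J) (vertex G)) (f : hyperedge G) :
    {set {x : vertex G | x \notin dep d}} :=
  if constant_fun (@contracted_interaction J G d f) then finset.set0
  else odflt finset.set0
    [pick B : {set {x : vertex G | x \notin dep d}} |
      (B \subset [set x | val x \in edge_set f :|: indep d]) &&
      [forall s, contracted_interaction f s == Phi_on (mset_of_set B) s]].

Definition edge_contraction (J : interaction_family) (G : hypergraph)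
    (d : splitting (spin J) (vertex G)) (e : hyperedge G) : hypergraph :=
  @Hypergraph {x : vertex G | x \notin dep d} {f : hyperedge G | f != e}
    (fun f => mset_of_set (contracted_edge d (val f))).

Record model := Model {
  mgraph : hypergraph;
  mspin : finType;
  interaction : hyperedge mgraph -> {ffun vertex mgraph -> mspin} -> bool
}.

Definition induced_model (J : interaction_family) (G : hypergraph) : model :=
  @Model G (spin J) (fun e s => Phi_on (incidence e) s).

Definition solution_count (M : model) (A : {set hyperedge (mgraph M)}) : nat :=
  #|[set s : {ffun vertex (mgraph M) -> mspin M} |
      [forall f in A, interaction f s]]|.

Definition model_rank (R : realType) (M : model) (A : {set hyperedge (mgraph M)}) :
    \bar R :=
  if 0 < solution_count A then
    (#|vertex (mgraph M)|%:R
       - ln (solution_count A)%:R / ln #|mspin M|%:R)%R%:E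
  else +oo%E.

Definition setfun_delete (E : finType) (Y : Type) (r : {set E} -> Y) (e : E)
    (A : {set {f : E | f != e}}) : Y :=
  r [set val f | f in A].

Definition setfun_contract (E : finType) (Y : Type) (r : {set E} -> Y) (e : E)
    (A : {set {f : E | f != e}}) : Y :=
  r ([set val f | f in A] :|: [set e]).

Definition model_deletion (J : interaction_family) (G : hypergraph)
    (e : hyperedge G) : model :=
  induced_model J (edge_deletion e).

Definition model_contraction (J : interaction_family) (G : hypergraph)
    (d : splitting (spin J) (vertex G)) (e : hyperedge G) : model :=
  induced_model J (edge_contraction d e).

Arguments model_rank R M A : clear implicits.

(* Main.v *)
Require Import Defs.
From mathcomp Require Import all_boot all_order all_algebra all_fingroup.
From mathcomp Require Import finmap multiset.
From mathcomp Require Import all_classical all_reals all_analysis.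

(** Both rank identities come down to equal numbers of solutions.  For the
    deletion the two solution sets coincide.  For the contraction,
    [sigma]-hat sends the assignments of [V \ D] bijectively onto the
    assignments of [V] that satisfy [e] ([decomposition_solutionsP]), and it
    turns the interaction of another hyperedge [f] into the interaction of
    [f^*] ([contracted_edgeP]).  Hence [R_M(A + e)] is the solution count of [A]
    in the contracted model ([solution_count_contraction]), and the two ranks
    differ by the number [|D|] of vertices removed.

    The delicate point is [contracted_edgeP] when the contracted interaction
    is constant.  Then [f^*] is empty and its interaction is identically 1, so
    the identity would fail if the constant were 0.  This is excluded by
    [uniform_assignment]: some spin [c] is such that the assignment with all
    entries equal to [c] satisfies every [Phi^k] at once.  To prove it, one
    first shows by strong induction on [k] that [Phi^k] is satisfied by some
    constant tuple ([diagonal_exists]).  A tuple that satisfies [Phi^k] and has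
    two equal entries ([collision]) lets loopblindness pass to fewer variables;
    such a tuple is lacking only when [Phi^2] is the graph of a
    fixed-point-free map, and this contradicts contraction-closedness
    ([pair_diagonal]).  Loopblindness on a single index then makes the spin
    independent of [k].

    When the contracted interaction is not constant, [f^*] is obtained by
    applying contraction-closedness to an enumeration of the union of [e] and
    [f] that starts with the given enumeration of [e]
    ([contracted_support_exists]); enumerating only that union also puts
    [f^*] inside the union of [f] and [I]. *)

Set Implicit Arguments.
Unset Strict Implicit.
Unset Printing Implicit Defensive.
Import Order.TTheory GRing.Theory Num.Theory.

(** * Interaction functions on lists *)

Section PhiSeq.
Variable J : interaction_family.

(** Stating facts on lists avoids transporting functions between the types
    ['I_k] for provably equal [k]. *)
Definition Phi_seq (w : seq (spin J)) : bool :=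
  Phi (finfun (tnth (in_tuple w))).

Lemma Phi_seq_tuple k (t : k.-tuple (spin J)) :
  Phi_seq t = Phi (finfun (tnth t)).
Proof.
case: t => w wk; rewrite /Phi_seq /=; have E := eqP wk; case: k / E wk => wk.
by rewrite (_ : in_tuple w = Tuple wk) //; apply: val_inj.
Qed.

Lemma Phi_seq_codom k (s : {ffun 'I_k -> spin J}) :
  Phi_seq [seq s i | i : 'I_k] = Phi s.
Proof.
have -> : [seq s i | i : 'I_k] = [tuple s i | i < k] by rewrite /= /image_mem.
rewrite Phi_seq_tuple; apply: (congr1 (@Phi J _)); apply/ffunP => i.
by rewrite ffunE tnth_mktuple.
Qed.

Lemma Phi_seq_perm (w1 w2 : seq (spin J)) :
  perm_eq w1 w2 -> Phi_seq w1 = Phi_seq w2.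
Proof.
move=> w12; have sz : size w1 == size w2 by rewrite (perm_size w12).
have := w12; rewrite -[w1]/(val (Tuple sz)) -[w2]/(val (in_tuple w2)).
move=> /tuple_permP[p ->]; rewrite !Phi_seq_tuple.
rewrite -(Phi_perm p (finfun (tnth (in_tuple w2)))).
apply: (congr1 (@Phi J _)); apply/ffunP => i.
by rewrite [LHS]ffunE tnth_mktuple ffunE ffunE.
Qed.

Lemma Phi_on_perm (T : finType) (A : {mset T}%mset) (r : seq T)
    (s : {ffun T -> spin J}) :
  perm_eq A r -> Phi_on A s = Phi_seq (map s r).
Proof. by move=> /(perm_map s)/Phi_seq_perm. Qed.

Lemma Phi_on_set (T : finType) (A : {set T}) (s : {ffun T -> spin J}) :
  Phi_on (mset_of_set A) s = Phi_seq [seq s x | x in A].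
Proof. exact/Phi_on_perm/perm_eq_seq_mset. Qed.

End PhiSeq.

Lemma Phi_on_imset (J : interaction_family) (T T' : finType) (g : T -> T')
    (A : {set T}) (s : {ffun T' -> spin J}) :
  injective g ->
  Phi_on (mset_of_set (g @: A)) s = Phi_on (mset_of_set A) [ffun x => s (g x)].
Proof.
move=> inj_g; rewrite !Phi_on_set; apply: Phi_seq_perm.
have -> : [seq [ffun x => s (g x)] x | x in A] = [seq s y | y <- map g (enum A)].
  by rewrite -map_comp; apply: eq_map => x; rewrite ffunE.
apply/perm_map/uniq_perm; rewrite ?enum_uniq ?(map_inj_uniq inj_g) ?enum_uniq //.
move=> y; rewrite mem_enum; apply/imsetP/mapP => -[x Ax ->]; exists x => //.
  by rewrite mem_enum.
by rewrite mem_enum in Ax.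
Qed.

Lemma Phi_on_const (J : interaction_family) (T : finType) (A : {mset T}%mset)
    (c : spin J) :
  Phi_on A [ffun=> c] = Phi_seq (nseq (size A) c).
Proof.
rewrite (Phi_on_perm _ (perm_refl _)); congr Phi_seq.
by elim: (A : seq T) => //= x r ->; rewrite ffunE.
Qed.

(** * Splittings and their extension maps *)

Section Splitting.
Variables (S T : finType).
Implicit Types (d : splitting S T) (s : {ffun T -> S}).

Definition free_part d s : {ffun {x : T | x \notin dep d} -> S} :=
  [ffun x => s (val x)].

Lemma extend_free d u (x : {x : T | x \notin dep d}) : extend u (val x) = u x.
Proof.
rewrite ffunE; case: {-}_ / boolP => [xD|xN]; first by case/negP: (valP x).
by congr (u _); apply: val_inj.
Qed.

Lemma extend_dep d (u : {ffun {x : T | x \notin dep d} -> S})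
    (x : {x : T | x \in dep d}) :
  extend u (val x) = depmap (Defs.restrict (indep d) (extend u)) x.
Proof.
rewrite ffunE; case: {-}_ / boolP => [xD|/negP[]]; last exact: valP.
congr (depmap _ _); last exact: val_inj.
apply/ffunP => i; rewrite !ffunE; case: {-}_ / boolP => [iD|iN].
  by have := indep_notin_dep i; rewrite iD.
by congr (u _); apply: val_inj.
Qed.

Lemma free_part_extend d u : free_part d (extend u) = u.
Proof. by apply/ffunP => x; rewrite ffunE extend_free. Qed.

(** As [free_part] is a left inverse of [extend], an assignment is in the image of
    [extend] exactly when it is a fixed point of their composite. *)
Lemma extend_free_partP d s :
  extend (free_part d s) = s <->
    Defs.restrict (dep d) s = depmap (Defs.restrict (indep d) s).
Proof.
split=> [<-|sD].
  by apply/ffunP => x; rewrite ffunE extend_dep.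
have sI :
    Defs.restrict (indep d) (extend (free_part d s)) = Defs.restrict (indep d) s.
  apply/ffunP => i; rewrite [LHS]ffunE [RHS]ffunE.
  by rewrite (extend_free _ (exist _ (val i) (indep_notin_dep i))) ffunE.
apply/ffunP => x; have [xD|xN] := boolP (x \in dep d).
  by rewrite (extend_dep _ (exist _ x xD)) sI -sD ffunE.
by rewrite (extend_free _ (exist _ x xN)) ffunE.
Qed.

End Splitting.

(** * Transporting splittings along injections *)

Section Transport.
Variables (S : finType).

Lemma transported_exists (T T' : finType) (g : T -> T') (d : splitting S T) :
  injective g -> exists d' : splitting S T', transported g d d'.
Proof.
move=> inj_g.
have dis : [disjoint g @: indep d & g @: dep d].
  apply/pred0P => y /=; apply/negbTE/negP => /andP[/imsetP[i iI ->]].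
  by rewrite mem_imset // (disjointFr (indep_dep_disjoint d) iI).
have pre (A : {set T}) (y : {y | y \in g @: A}) :
      {x : {x | x \in A} | g (val x) = val y}.
  have [x xA yE] := cid2 (imsetP (valP y)).
  by exists (exist _ x xA).
exists (@Splitting S T' (g @: indep d) (g @: dep d) dis (fun s' : assignment S _ =>
  [ffun y => depmap [ffun x : {x | x \in indep d} =>
      s' (exist _ (g (val x)) (imset_f g (valP x)))] (sval (pre _ y))])).
split=> //= s s' ss' x y yx; rewrite ffunE; congr (depmap _ _).
  by apply/ffunP => z; rewrite ffunE; apply: ss'.
by apply/val_inj/inj_g; rewrite (svalP (pre _ y)).
Qed.

(** Used with [T] the index set of [e], [T'] a larger index set and [T''] the
    vertices: the splitting of [e] seen on ['I_n] by way of [widen_ord], where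
    contraction-closedness speaks, also transports to the vertices. *)
Lemma transported_factor (T T' T'' : finType) (g : T -> T') (h : T' -> T'')
    (f : T -> T'') (d : splitting S T) (d' : splitting S T')
    (d'' : splitting S T'') :
  injective h -> h \o g =1 f ->
  transported g d d' -> transported f d d'' -> transported h d' d''.
Proof.
move=> inj_h hg [I' D' map'] [I'' D'' map''].
have im (A : {set T}) : f @: A = h @: (g @: A).
  by rewrite -imset_comp; apply: eq_imset => x; rewrite -hg.
have gI (x : {x | x \in indep d}) : g (val x) \in indep d'.
  by rewrite I' imset_f // (valP x).
split; rewrite ?I' ?D' //; first by rewrite I'' im.
  by rewrite D'' im.
move=> s' s'' ss y y'' yy.
pose s : assignment S (indep d) := [ffun x => s' (exist _ (g (val x)) (gI x))].
have /imsetP[x xD yE] : val y \in g @: dep d by rewrite -D' (valP y).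
have ss' : corresponds g s s'.
  by move=> i j ij; rewrite ffunE; congr (s' _); apply: val_inj; rewrite ij.
have ss'' : corresponds f s s''.
  by move=> i j ij; rewrite ffunE; apply: ss => /=; rewrite ij -hg.
rewrite -(map' s s' ss' (exist _ x xD) y yE); apply: map'' => //.
by rewrite yy yE -hg.
Qed.

Variables (T T' : finType) (h : T -> T').
Variables (d : splitting S T) (d' : splitting S T').
Hypotheses (inj_h : injective h) (tr : transported h d d').

Lemma transported_notin_dep (x : {x : T | x \notin dep d}) :
  h (val x) \notin dep d'.
Proof. by case: tr => _ D' _; rewrite D' mem_imset // (valP x). Qed.

Definition free_map (x : {x : T | x \notin dep d}) :
    {y : T' | y \notin dep d'} :=
  exist _ (h (val x)) (transported_notin_dep x).

Lemma free_map_inj : injective free_map.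
Proof. by move=> x y /(congr1 val)/inj_h/val_inj. Qed.

Lemma restrict_corresponds (A : {set T}) (A' : {set T'}) (s : {ffun T' -> S}) :
  corresponds h (Defs.restrict A [ffun x => s (h x)]) (Defs.restrict A' s).
Proof. by move=> i j ij; rewrite [RHS]ffunE ij !ffunE. Qed.

Lemma transported_fixed (s : {ffun T' -> S}) :
  extend (free_part d [ffun x => s (h x)]) = [ffun x => s (h x)] <->
  extend (free_part d' s) = s.
Proof.
rewrite !extend_free_partP; case: (tr) => hI hD hcorr.
have hmap := hcorr _ _ (@restrict_corresponds (indep d) (indep d') s).
split=> eqs; apply/ffunP => x.
  have /imsetP[y yD xE] : val x \in h @: dep d by rewrite -hD (valP x).
  rewrite -(hmap (exist _ y yD) x xE) -eqs !ffunE.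
  by rewrite xE.
have hxD : h (val x) \in dep d' by rewrite hD imset_f // (valP x).
by rewrite (hmap x (exist _ (h (val x)) hxD)) // -eqs !ffunE.
Qed.

(** Extending commutes with pulling back along [h]; [free_map] is what [h] does
    on the complement of the dependent part. *)
Lemma transported_extend (u : {ffun {y : T' | y \notin dep d'} -> S}) :
  [ffun x => extend u (h x)] = extend [ffun x => u (free_map x)].
Proof.
rewrite -[LHS](transported_fixed (extend u)).2 ?free_part_extend //.
congr extend; apply/ffunP => x; rewrite [LHS]ffunE ffunE [RHS]ffunE.
by rewrite -(extend_free u (free_map x)).
Qed.

End Transport.

(** * Tuples allowed by a representable interaction *)

Section Representation.
Variable J : interaction_family.

Lemma spin_inhabited : exists c : spin J, true.
Proof. by have /card_gt0P[c _] := ltnW (spin_gt1 J); exists c. Qed.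

Section OneArity.
Variables (k : nat) (d : splitting (spin J) 'I_k).
Hypothesis rep : represents d.

Lemma Phi_extendP (s : {ffun 'I_k -> spin J}) :
  Phi s <-> extend (free_part d s) = s.
Proof.
have [_ /(_ s)] := rep; rewrite inE extend_free_partP => ->.
by split=> [[_ [<- ->]]|eqs] //; exists (Defs.restrict (indep d) s).
Qed.

Lemma Phi_extend (u : {ffun {x : 'I_k | x \notin dep d} -> spin J}) :
  Phi (extend u).
Proof. by apply/Phi_extendP; rewrite free_part_extend. Qed.

Lemma card_indep_dep : #|indep d| + #|dep d| = k.
Proof.
have [cov _] := rep.
rewrite -[RHS]card_ord -cardsT -cov cardsU disjoint_setI0 ?cards0 ?subn0 //.
exact: indep_dep_disjoint.
Qed.

(** Two independent entries can be given the same value.  Two dependent entries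
    are always equal: exchanging them gives, by symmetry of [Phi^k], another
    allowed tuple with the same independent part.  Only one independent and
    one dependent entry escape this. *)
Lemma collision : 1 < k -> ~~ ((k == 2) && (#|dep d| == 1)) ->
  exists i j, exists2 s : {ffun 'I_k -> spin J}, Phi s & i != j /\ s i = s j.
Proof.
move=> k_gt1 nK; have [c _] := spin_inhabited.
pose s := @extend _ _ d [ffun=> c].
have sP : Phi s := Phi_extend _.
have [] := leqP 2 #|dep d|.
  case/card_gt1P => i [j [iD jD ij]]; exists i, j; exists s => //; split=> //.
  pose s' := [ffun x => s (tperm i j x)].
  have /Phi_extendP s'P : Phi s' by rewrite Phi_perm.
  have ss' : free_part d s' = free_part d s.
    apply/ffunP => x; rewrite !ffunE tpermD //.
      by apply: contraNneq (valP x) => <-.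
    by apply: contraNneq (valP x) => <-.
  have /ffunP/(_ i) : s' = s by rewrite -s'P ss'; apply/Phi_extendP.
  by rewrite ffunE tpermL => ->.
move=> D1; have : 2 <= #|indep d|.
  have := card_indep_dep; move: D1 nK; case: #|dep d| => [|[|//]] _ /=.
    by move=> _; rewrite addn0 => ->.
  rewrite andbT addn1 => k2 kE; move: #|indep d| kE k_gt1 k2 => a <-.
  by case: a => [|[]].
case/card_gt1P => i [j [iI jI ij]]; exists i, j; exists s => //; split=> //.
have sc x : x \in indep d -> s x = c.
  move=> xI; have xN : x \notin dep d := indep_notin_dep (exist _ x xI).
  by rewrite (extend_free _ (exist _ x xN)) ffunE.
by rewrite !sc.
Qed.

End OneArity.
End Representation.

(** * A spin satisfying all interactions *)

Section Diagonal.
Variable J : interaction_family.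

Lemma Phi_on_set_const (T : finType) (A : {set T}) (c : spin J) :
  Phi_on (mset_of_set A) [ffun=> c] = Phi_seq (nseq #|A| c).
Proof. by rewrite Phi_on_const (perm_size (perm_eq_seq_mset _)) -cardE. Qed.

Lemma seq_le1_const (w : seq (spin J)) :
  size w <= 1 -> exists c, w = nseq (size w) c.
Proof.
have [c _] := spin_inhabited J.
by case: w => [|a [|//]] _; [exists c | exists a].
Qed.

(** Suppose that no pair [(z, z)] is allowed, and let [y] be the partner of
    [x].  Contract the edge with entries [i] and [j] in a hypergraph that has a
    third vertex, and look at the edge joining [j] to the third vertex, as a
    function of the values at [i] and at the third vertex.  It is 1 at
    [(z, z)] for every [z], and 0 at [(x, y)] because [(y, y)] is not allowed.
    So it is a nonconstant [Phi] of at most two variables that is 1 whenever all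
    variables agree: with two variables this contradicts the assumption, with
    fewer it is constant. *)
Lemma pair_diagonal (d : splitting (spin J) 'I_2) :
  contraction_closed J -> represents d -> #|dep d| = 1 ->
  exists c : spin J, Phi_seq (nseq 2 c).
Proof.
move=> cc rep /eqP/cards1P[j Dj].
have [//|no] := pselect (exists c : spin J, Phi_seq (nseq 2 c)).
have noP (c : spin J) : Phi_seq [:: c; c] = false.
  by apply/negP => Pc; apply: no; exists c.
have [i ij] : exists i, i != j.
  by case: (j) => [[|[|//]] ?]; [exists ord_max | exists ord0].
have Phi2 (s : {ffun 'I_2 -> spin J}) : Phi s = Phi_seq [:: s i; s j].
  rewrite -Phi_seq_codom.
  apply/Phi_seq_perm/(@perm_map _ _ s _ [:: i; j])/uniq_perm.
  - exact: enum_uniq.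
  - by rewrite /= inE ij.
  have uij : uniq [:: i; j] by rewrite /= inE ij.
  have [] := uniq_min_size uij (s2 := enum 'I_2) _ _; rewrite ?size_enum_ord //.
    by move=> x _; rewrite mem_enum.
  by move=> _ e x; rewrite e.
pose w := widen_ord (isT : 2 <= 3); have inj_w : injective w.
  by move=> x y /(congr1 val) xy; apply: val_inj.
have wN x : (w x == ord_max) = false by case: x => [[|[|]]].
have [d' tr] := transported_exists d inj_w.
have D' : dep d' = [set w j] by case: tr => _ D' _; rewrite D' Dj imset_set1.
have mN : ord_max \notin dep d' by rewrite D' inE eq_sym wN.
pose u x y : {ffun {z | z \notin dep d'} -> spin J} :=
  [ffun z => if val z == ord_max then y else x].
pose A := [set w j; ord_max].
have PhiA (t : {ffun 'I_3 -> spin J}) :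
    Phi_on (mset_of_set A) t = Phi_seq [:: t (w j); t ord_max].
  rewrite Phi_on_set.
  apply/Phi_seq_perm/(@perm_map _ _ t _ [:: w j; ord_max])/uniq_perm.
  - exact: enum_uniq.
  - by rewrite /= inE wN.
  - by move=> x; rewrite mem_enum !inE.
have [x _] := spin_inhabited J.
have partner (z : spin J) : exists2 y, Phi_seq [:: z; y] &
    forall t, Phi_on (mset_of_set A) (extend (u z t)) = Phi_seq [:: y; t].
  pose s := @extend _ _ d [ffun=> z]; exists (s j).
    have iN : i \notin dep d by rewrite Dj inE.
    have <- : s i = z by rewrite (extend_free _ (exist _ i iN)) ffunE.
    by rewrite -Phi2; exact: Phi_extend.
  move=> t; rewrite PhiA.
  have -> : extend (u z t) ord_max = t.
    by rewrite (extend_free _ (exist _ ord_max mN)) ffunE eqxx.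
  have /ffunP/(_ j) := transported_extend inj_w tr (u z t); rewrite ffunE => ->.
  rewrite (_ : [ffun _ => _] = [ffun=> z]) //.
  by apply/ffunP => y; rewrite !ffunE /= wN.
have diagA z : Phi_on (mset_of_set A) (extend (u z z)).
  have [y zy ->] := partner z.
  by rewrite (Phi_seq_perm (permEl (perm_catC [:: y] [:: z]))).
have offA : exists y, Phi_on (mset_of_set A) (extend (u x y)) = false.
  by have [y _ e] := partner x; exists y; rewrite e noP.
have [y xyA] := offA.
have [/forallP/(_ (u x x))/forallP/(_ (u x y))|[A' [eA' _]]] :=
  cc 2 3 isT d' (ex_intro2 _ _ d rep tr) A.
  by rewrite xyA diagA.
have uz z : u z z = [ffun=> z] by apply/ffunP => v; rewrite !ffunE if_same.
have A'z (z : spin J) : Phi_seq (nseq #|A'| z) by rewrite -Phi_on_set_const -uz -eA'.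
have A'2 : #|A'| <= 2.
  rewrite (leq_trans (max_card _)) // card_sig.
  by have := cardC (mem (dep d')); rewrite card_ord D' cards1 add1n => -[] /eq_leq.
move: xyA; rewrite eA' Phi_on_set; set v := image_mem _ _.
have sv : size v = #|A'| by exact: size_image.
have [v1|v2] := leqP (size v) 1.
  by have [z ->] := seq_le1_const v1; rewrite sv A'z.
by have := A'z x; rewrite (_ : #|A'| = 2) ?noP //; apply/eqP; rewrite eqn_leq A'2 -sv.
Qed.

(** Identifying the two equal entries of a [collision] gives an interaction on
    fewer variables that is not identically 0.  It is either constant 1, and
    every constant tuple is allowed, or, by loopblindness, a [Phi] of smaller
    arity, to which induction applies. *)
Lemma diagonal_exists :
  loopblind J -> functionally_representable J -> contraction_closed J ->
  forall k, exists c : spin J, Phi_seq (nseq k c).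
Proof.
move=> lb fr cc; elim/ltn_ind => k IH.
have [d rep] := fr k; have [c0 _] := spin_inhabited J.
have [k1|k2] := leqP k 1.
  have := Phi_extend rep [ffun=> c0]; rewrite -Phi_seq_codom.
  set w := image_mem _ _; have sw : size w = k by rewrite size_image card_ord.
  have [|c ->] := @seq_le1_const w; first by rewrite sw.
  by rewrite sw; exists c.
have [/andP[/eqP k2E /eqP D1]|nK] := boolP ((k == 2) && (#|dep d| == 1)).
  by move: k2E d rep D1 => -> d; exact: pair_diagonal.
have [i [j [s sP [ij sij]]]] := collision rep k2 nK.
(* [m] redirects [j] to [i], so the multiset [A] below misses [j]. *)
pose m (x : 'I_k) := if x == j then i else x.
have mj x : (m x == j) = false.
  by rewrite /m; case: (eqVneq x j) => [_|/negbTE] //; apply: negbTE.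
pose A := seq_mset (map m (enum 'I_k)).
have sA : size A = k.
  by rewrite (perm_size (perm_eq_seq_mset _)) size_map size_enum_ord.
have As : Phi_on A s.
  rewrite (Phi_on_perm _ (perm_eq_seq_mset _)) -map_comp.
  have -> : [seq (s \o m) x | x <- enum 'I_k] = [seq s x | x : 'I_k].
    by apply: eq_map => x /=; rewrite /m; case: eqP => // ->.
  by rewrite Phi_seq_codom.
have [cst|ncst] :=
  boolP (constant_fun (fun s : {ffun 'I_k -> spin J} => Phi_on A s)).
  exists c0; rewrite -sA -Phi_on_const.
  by have /forallP/(_ s)/forallP/(_ [ffun=> c0])/eqP <- := cst.
have [A' [[subA' eqA'] _]] := lb k A (ltnW k2) ncst.
have A'k : #|A'| < k.
  have jA' : j \notin A'.
    apply/negP => /subA'; rewrite (perm_mem (perm_eq_seq_mset _)).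
    by case/mapP => x _ /eqP; rewrite eq_sym mj.
  have sub : A' \subset [set~ j].
    by apply/fintype.subsetP => x xA'; rewrite !inE; apply: contraNneq jA' => <-.
  by rewrite (leq_ltn_trans (subset_leq_card sub)) // cardsC1 card_ord ltn_predL ltnW.
have [c A'c] := IH _ A'k; exists c.
by rewrite -{1}sA -Phi_on_const eqA' Phi_on_set_const.
Qed.

(** On a constant tuple [Phi^k] is a function of one spin.  By loopblindness it is
    constant, hence 1 by [diagonal_exists], or it is [Phi^1]: any spin
    allowed by [Phi^1] works for all [k]. *)
Lemma uniform_assignment :
  loopblind J -> functionally_representable J -> contraction_closed J ->
  exists c : spin J, forall k, Phi_seq (nseq k c).
Proof.
move=> lb fr cc; have diag := diagonal_exists lb fr cc.
have [c1 c1P] := diag 1; exists c1 => k; have [c cP] := diag k.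
pose A := seq_mset (nseq k (ord0 : 'I_1)).
have PhiA z : Phi_on A [ffun=> z] = Phi_seq (nseq k z).
  by rewrite Phi_on_const (perm_size (perm_eq_seq_mset _)) size_nseq.
rewrite -PhiA.
have [cst|ncst] :=
  boolP (constant_fun (fun s : {ffun 'I_1 -> spin J} => Phi_on A s)).
  have /forallP/(_ [ffun=> c1])/forallP/(_ [ffun=> c])/eqP -> := cst.
  by rewrite PhiA.
have [A' [[_ ->] _]] := lb 1 A isT ncst; rewrite Phi_on_set_const.
have := max_card A'; rewrite card_ord; case: #|A'| => [|[|//]] // _.
by have [c' ] := diag 0.
Qed.

End Diagonal.

(** * Reindexing hyperedges *)

Lemma Phi_on_preimset (J : interaction_family) (T T' : finType)
    (h : T -> T') (A : {set T'}) (s : {ffun T' -> spin J}) :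
  injective h -> A \subset h @: [set: T] ->
  Phi_on (mset_of_set A) s
    = Phi_on (mset_of_set (h @^-1: A)) [ffun x => s (h x)].
Proof.
move=> inj_h /fintype.subsetP sub; rewrite -Phi_on_imset //.
congr (Phi_on (mset_of_set _) _).
apply/setP => y; apply/idP/imsetP => [yA|[x]]; last by rewrite inE => ? ->.
by have /imsetP[x _ yE] := sub y yA; exists x; rewrite // inE -yE.
Qed.

(** [contraction_closed] concerns index sets of which the contracted edge is an
    initial segment, hence the requirement on [widen_ord]. *)
Lemma enumeration_extends (T : finType) (k : nat) (g : 'I_k -> T)
    (F : {set T}) :
  injective g ->
  exists n (lekn : k <= n) (h : 'I_n -> T),
    [/\ injective h, h \o widen_ord lekn =1 g
      & h @: [set: 'I_n] = F :|: g @: [set: 'I_k]].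
Proof.
move=> inj_g; pose r := [seq g i | i <- enum 'I_k].
have mem_r x : (x \in r) = (x \in g @: [set: 'I_k]).
  by apply/mapP/imsetP => -[i _ ->]; exists i; rewrite ?mem_enum ?inE.
pose w := r ++ enum (F :\: g @: [set: 'I_k]).
have sr : size r = k by rewrite size_map size_enum_ord.
have lekn : k <= size w by rewrite size_cat sr leq_addr.
exists (size w), lekn, (tnth (in_tuple w)); split.
- apply/tuple_uniqP; rewrite /= cat_uniq map_inj_uniq ?enum_uniq // andbT.
  by apply/hasPn => x; rewrite mem_enum inE mem_r => /andP[].
- move=> i /=; rewrite (tnth_nth (g i)) /= nth_cat sr ltn_ord.
  by rewrite (nth_map i) ?size_enum_ord // nth_ord_enum.
apply/setP => x; rewrite !inE; apply/imsetP/idP => [[i _ ->]|xw].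
  have := mem_tnth i (in_tuple w); rewrite mem_cat mem_r mem_enum !inE.
  by case/orP => [->|/andP[_ ->]]; rewrite ?orbT.
have : x \in in_tuple w.
  by rewrite mem_cat mem_r mem_enum !inE; case: (x \in imset _ _) xw; rewrite ?orbF.
by case/tnthP => i ->; exists i.
Qed.

(** * Contraction and deletion *)

Section Contraction.
Variables (J : interaction_family) (G : hypergraph).
Hypothesis loopG : loopless G.

Lemma Phi_on_incidence (f : hyperedge G) (s : {ffun vertex G -> spin J}) :
  Phi_on (incidence f) s = Phi_on (mset_of_set (edge_set f)) s.
Proof.
rewrite Phi_on_set; apply: Phi_on_perm; apply/allP => x _ /=; apply/eqP.
rewrite count_mem_mset count_uniq_mem ?enum_uniq // mem_enum inE -mset_neq0.
by have := loopG f x; case: (incidence f x) => [|[]].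
Qed.

Variables (e : hyperedge G) (d : splitting (spin J) (vertex G)).
Hypothesis dec : decomposition e d.

Lemma decomposition_solutionsP (s : {ffun vertex G -> spin J}) :
  Phi_on (incidence e) s <-> extend (free_part d s) = s.
Proof.
case: dec => g [inj_g gE [d0 rep tr]].
rewrite Phi_on_incidence -gE Phi_on_imset // Phi_on_set.
rewrite /image_mem enum_setT -enumT Phi_seq_codom.
have P1 := Phi_extendP rep [ffun i => s (g i)].
exact: (iff_trans P1 (transported_fixed tr s)).
Qed.

Lemma decomposition_cover : edge_set e = indep d :|: dep d.
Proof.
case: dec => g [_ gE [d0 [cov _] [I' D' _]]].
by rewrite -gE I' D' -imsetU cov.
Qed.

Hypotheses (lb : loopblind J) (fr : functionally_representable J).
Hypothesis cc : contraction_closed J.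

(** The index set enumerates exactly the union of [f] and [e], so every vertex
    of the support found by contraction-closedness is in [f] or in [e] but
    not in [D], that is, in [f] or in [I]. *)
Lemma contracted_support_exists (f : hyperedge G) :
  ~~ constant_fun (@contracted_interaction J G d f) ->
  exists2 B : {set {x : vertex G | x \notin dep d}},
    B \subset [set x | val x \in edge_set f :|: indep d] &
    forall s, contracted_interaction f s = Phi_on (mset_of_set B) s.
Proof.
move=> ncst; case: dec => g [inj_g gE [d0 rep tr]].
have [n [lekn [h [inj_h hg hE]]]] := enumeration_extends (edge_set f) inj_g.
have inj_w : injective (widen_ord lekn).
  by move=> x y /(congr1 val) xy; apply: val_inj.
have [d' tr'] := transported_exists d0 inj_w.
have trh := transported_factor inj_h hg tr' tr.
have pull s : contracted_interaction f s =
    Phi_on (mset_of_set (h @^-1: edge_set f))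
      (extend [ffun x => s (free_map inj_h trh x)]).
  rewrite -transported_extend /contracted_interaction Phi_on_incidence.
  by apply: Phi_on_preimset; rewrite // hE finset.subsetUl.
have [/forallP cst|[A' [eqA' _]]] :=
  cc (ex_intro2 _ _ d0 rep tr') (h @^-1: edge_set f).
  case/negP: ncst; apply/forallP => s; apply/forallP => t; rewrite !pull.
  by have /forallP := cst [ffun x => s (free_map inj_h trh x)]; apply.
exists (free_map inj_h trh @: A').
  apply/fintype.subsetP => _ /imsetP[y _ ->]; rewrite inE.
  have : val (free_map inj_h trh y) \in h @: [set: 'I_n] by apply: imset_f.
  have : val (free_map inj_h trh y) \notin dep d := valP (free_map inj_h trh y).
  move: (val _) => x /negbTE xN.
  by rewrite hE gE decomposition_cover !finset.in_setU xN orbF.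
by move=> s; rewrite pull eqA' Phi_on_imset //; exact: free_map_inj.
Qed.

(** In the constant case the value is read off at an assignment with all entries
    equal to a spin from [uniform_assignment]; that assignment satisfies [e],
    so it is in the image of [extend], and it satisfies [f]. *)
Lemma contracted_edgeP (f : hyperedge G) s :
  contracted_interaction f s = Phi_on (mset_of_set (contracted_edge d f)) s.
Proof.
rewrite /contracted_edge; case: ifPn => [cst|ncst]; last first.
  have [B subB eqB] := contracted_support_exists ncst.
  case: pickP => [C /andP[_ /forallP/(_ s)/eqP] //|/(_ B)].
  by rewrite subB => /negP[]; apply/forallP => t; rewrite eqB.
have [c cP] := uniform_assignment lb fr cc.
rewrite Phi_on_set /image_mem enum_set0 (cP 0).
have /forallP/(_ s)/forallP/(_ (free_part d [ffun=> c]))/eqP -> := cst.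
rewrite /contracted_interaction (decomposition_solutionsP _).1 Phi_on_const;
  exact: cP.
Qed.

Lemma solution_count_contraction (A : {set {f : hyperedge G | f != e}}) :
  @solution_count (induced_model J G) ([set val f | f in A] :|: [set e])
    = @solution_count (model_contraction d e) A.
Proof.
rewrite /solution_count -(card_imset _ (can_inj (@free_part_extend _ _ d))).
apply: eq_card => s; rewrite inE; apply/forall_inP/imsetP => [sol|[u]].
  have es : extend (free_part d s) = s.
    by apply/decomposition_solutionsP/(sol e); rewrite !inE eqxx orbT.
  exists (free_part d s) => //; rewrite inE; apply/forall_inP => f fA /=.
  rewrite -contracted_edgeP /contracted_interaction es.
  by apply: (sol (val f)); rewrite inE imset_f.
rewrite inE => /forall_inP sol -> f.
rewrite !inE => /orP[/imsetP[f' f'A ->]|/eqP ->] /=.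
  by have := sol f' f'A; rewrite /= -contracted_edgeP.
by apply/decomposition_solutionsP; rewrite free_part_extend.
Qed.

End Contraction.

Lemma solution_count_deletion (J : interaction_family) (G : hypergraph)
    (e : hyperedge G) (A : {set {f : hyperedge G | f != e}}) :
  @solution_count (induced_model J G) [set val f | f in A]
    = @solution_count (model_deletion J e) A.
Proof.
apply: eq_card => s; rewrite !inE; apply/forall_inP/forall_inP => sol f.
  by move=> fA; apply: (sol (val f)); rewrite imset_f.
by case/imsetP => f' f'A ->; exact: (sol f').
Qed.

Theorem theorem3p22 (R : realType) (J : interaction_family) (G : hypergraph)
    (e : hyperedge G) (d : splitting (spin J) (vertex G)) :
  loopblind J ->
  functionally_representable J ->
  contraction_closed J ->
  loopless G ->
  decomposition e d ->
  forall A : {set {f : hyperedge G | f != e}},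
    setfun_contract (model_rank R (induced_model J G)) A
      = ((#|dep d|%:R)%:E + model_rank R (model_contraction d e) A)%E
    /\
    setfun_delete (model_rank R (induced_model J G)) A
      = model_rank R (model_deletion J e) A.
Proof.
move=> lb fr cc loopG dec A; split; last first.
  by rewrite /setfun_delete /model_rank solution_count_deletion.
rewrite /setfun_contract /model_rank.
rewrite (solution_count_contraction loopG dec lb fr cc).
case: ifP => _; last by rewrite addey.
rewrite -EFinD; congr EFin.
have -> : #|vertex G| = #|dep d| + #|{: {x : vertex G | x \notin dep d}}|.
  by rewrite card_sig -[LHS](cardC (mem (dep d))).
by rewrite natrD -addrA.
Qed.
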